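(* Let $\theta=(k_r)$ be a lacunary sequence and let $q_r=k_r/k_{r-1}$. If $\liminf_{r} q_r>1$, then $AC_{\sigma_1}\subseteq AC_{\theta}$.
   Context: Let $w$ be the space of all sequences $x=(x_k)_{k\in\mathbb{N}}$ of complex numbers. For integers $m,n$, $\langle m,n\rangle$ denotes the greatest common divisor of $m$ and $n$. A lacunary sequence is an increasing sequence of integers $\theta=(k_r)_{r\ge 0}$, with $k_0\neq 0$, such that $h_r=k_r-k_{r-1}\to\infty$ as $r\to\infty$; put $I_r=(k_{r-1},k_r]$ and $q_r=k_r/k_{r-1}$ for $r\ge 1$ (the indices $m\in I_r$ below are natural numbers). Define $$AC_{\theta}=\left\{(x_m)\in w:\ \lim_{r\to\infty}\frac{1}{h_r}\sum_{m\in I_r}\left|x_m-x_{\langle m,n\rangle}\right|=0\ \text{for some integer } n\right\},$$ $$AC_{\sigma_1}=\left\{(x_m)\in w:\ \text{there exists an integer } n \text{ such that } \frac{1}{t}\sum_{m=1}^{t}\left|x_m-x_{\langle m,n\rangle}\right|\to 0\ \text{as } t\to\infty\right\}.$$ *)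

(* Defs.v *)
From HB Require Import structures.
From mathcomp Require Import all_boot all_order all_algebra.
From mathcomp Require Import all_classical all_reals all_analysis.
From mathcomp Require Import complex.
Import Order.TTheory GRing.Theory Num.Theory.
Import numFieldNormedType.Exports.

Set Implicit Arguments.
Unset Strict Implicit.
Unset Printing Implicit Defensive.

Local Open Scope classical_set_scope.
Local Open Scope ring_scope.
Local Open Scope complex_scope.

(* The paper's h_r, q_r and I_r are indexed by r >= 1.  At r = 0 the value
   0.-1 = 0 gives a junk term, which is invisible to limits and liminf. *)
Definition lac_gap (k : nat -> int) (r : nat) : int := k r - k r.-1.

Definition lac_ratio (R : realType) (k : nat -> int) (r : nat) : R :=
  (k r)%:~R / (k r.-1)%:~R.

Definition lacunary (R : realType) (k : nat -> int) : Prop :=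
  [/\ forall r s : nat, (r < s)%N -> k r < k s,
      k 0%N != 0
    & (fun r => (lac_gap k r)%:~R : R) @ \oo --> +oo].

(* |x_m - x_<m,n>| as an element of R: the norm of the numFieldType R[i] is
   itself R[i]-valued, whereas normc is its real-valued version. *)
Definition arith_dev (R : realType) (x : nat -> R[i]) (n : int) (m : nat) : R :=
  ComplexField.Normc.normc (x m - x `|gcdz m%:Z n|%N).

(* Sequences are indexed by m >= 1: the value x 0 is never used.  The integer n
   is nonzero because <m, 0> = m would put every sequence in both spaces. *)
Definition AC_theta (R : realType) (k : nat -> int) : set (nat -> R[i]) :=
  [set x | exists2 n : int, n != 0 &
    (fun r => ((lac_gap k r)%:~R)^-1 *
       \sum_(1 <= m < `|k r|%N.+1 | k r.-1 < m%:Z <= k r) arith_dev x n m)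
      @ \oo --> (0 : R)].

Definition AC_sigma1 (R : realType) : set (nat -> R[i]) :=
  [set x | exists2 n : int, n != 0 &
    (fun t : nat => (t%:R)^-1 * \sum_(1 <= m < t.+1) arith_dev x n m)
      @ \oo --> (0 : R)].

Arguments lac_ratio : clear implicits.
Arguments lacunary : clear implicits.
Arguments AC_theta : clear implicits.
Arguments AC_sigma1 : clear implicits.

(* Main.v *)
(* With h_r = k_r - k_{r-1}, the block mean over I_r is at most k_r / h_r times
   the Cesaro mean at t = k_r.  Since q_r is eventually above some a > 1, the
   factor k_r / h_r is eventually bounded by a / (a - 1). *)
Require Import Defs.
From mathcomp Require Import all_boot all_order all_algebra.
From mathcomp Require Import all_classical all_reals all_analysis.
From mathcomp Require Import complex.
From mathcomp Require Import zify lra.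
Import Order.TTheory GRing.Theory Num.Theory.
Import numFieldNormedType.Exports.

Local Open Scope classical_set_scope.
Local Open Scope ring_scope.

(** The lower limit is the supremum of the tail infima, so some tail has an infimum above [a], and
    every term of that tail exceeds [a]. *)
Lemma near_gt_limn_einf (R : realType) (u : nat -> \bar R) (a : \bar R) :
  (a < limn_einf u)%E -> \forall r \near \oo, (a < u r)%E.
Proof.
rewrite limn_einf_lim (cvg_lim _ (@cvg_einfs_sup R u))//.
move=> /ereal_sup_gt[_ [N _ <-]] aN; near=> r.
apply: (lt_le_trans aN); apply: ereal_inf_lbound; exists r => //=.
by near: r; exact: nbhs_infty_ge.
Unshelve. all: by end_near. Qed.

(** Supplies a real [a] for the constant [a / (a - 1)], even when the lower limit is infinite. *)
Lemma EFin_between (R : realFieldType) (x : R) (L : \bar R) :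
  (x%:E < L)%E -> exists2 a : R, x < a & (a%:E < L)%E.
Proof.
case: L => [l||//]; last by move=> _; exists (x + 1); rewrite ?ltry//; lra.
by rewrite lte_fin => xl; exists ((x + l) / 2); rewrite ?lte_fin; lra.
Qed.

Lemma increasing_int_ge (k : nat -> int) :
  (forall r s : nat, (r < s)%N -> k r < k s) -> forall r : nat, k 0%N + r%:Z <= k r.
Proof.
move=> kincr; elim=> [|r IH]; first by rewrite addr0.
have := kincr r r.+1 (ltnSn r); lia.
Qed.

(** [k 0] may be negative, but integer steps are at least 1, so positivity holds eventually. *)
Lemma near_increasing_int_gt0 (k : nat -> int) :
  (forall r s : nat, (r < s)%N -> k r < k s) -> \forall r \near \oo, 0 < k r.-1.
Proof.
move=> kincr; near=> r; have := increasing_int_ge k kincr r.-1.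
suff : (`|k 0%N|.+2 <= r)%N by lia.
by near: r; exact: nbhs_infty_ge.
Unshelve. all: by end_near. Qed.

Lemma absz_increasing_cvgny (k : nat -> int) :
  (forall r s : nat, (r < s)%N -> k r < k s) -> `|k r|%N @[r --> \oo] --> \oo.
Proof.
move=> kincr; apply/cvgnyPge => A; near=> r.
have := increasing_int_ge k kincr r.
suff : (A + `|k 0%N| <= r)%N by lia.
by near: r; exact: nbhs_infty_ge.
Unshelve. all: by end_near. Qed.

Lemma arith_dev_ge0 (R : realType) (x : nat -> R[i]) (n : int) (m : nat) :
  0 <= arith_dev x n m.
Proof. by rewrite /arith_dev; case: (_ - _) => a b; exact: sqrtr_ge0. Qed.

(** After clearing the positive denominators, the claim is [(a - 1) * q <= a * (q - p)], which
    amounts to [a * p <= q]. *)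
Lemma gap_inv_le (R : realFieldType) (a p q : R) :
  1 < a -> 0 < p -> a < q / p -> (q - p)^-1 <= a / (a - 1) * q^-1.
Proof.
move=> a1 p0; rewrite ltr_pdivlMr// => apq.
have pap : p < a * p by rewrite ltr_pMl.
have qp0 : 0 < q - p by lra.
have q0 : 0 < q by lra.
rewrite mulrAC ler_pdivlMr; last lra.
rewrite mulrC ler_pdivrMr// mulrAC ler_pdivlMr//; lra.
Qed.

Theorem theorem2p6 (R : realType) (k : nat -> int)
    (hk : lacunary R k)
    (hq : (1%:E < limn_einf (fun r => (lac_ratio R k r)%:E))%E) :
  AC_sigma1 R `<=` AC_theta R k.
Proof.
have [kincr _ _] := hk.
move=> x [n n0 xn]; exists n => //.
have [a a1 /near_gt_limn_einf aq] := EFin_between _ _ _ hq.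
have kpos := near_increasing_int_gt0 k kincr.
(* The majorant is a constant times the Cesaro means along the indices [|k r|], which tend to
   infinity. *)
have bound0 : a / (a - 1) * ((`|k r|%N%:R)^-1 *
    \sum_(1 <= m < `|k r|%N.+1) arith_dev x n m) @[r --> \oo] --> (0 : R).
  rewrite -[X in _ --> X](mulr0 (a / (a - 1))).
  by apply: cvgM; [exact: cvg_cst | exact: cvg_comp (absz_increasing_cvgny k kincr) xn].
apply: squeeze_cvgr (cvg_cst 0) bound0; near=> r.
have p0 : 0 < k r.-1 by near: r.
have aqr : a < lac_ratio R k r by rewrite -lte_fin; near: r.
(* Excludes [r = 0], where [r.-1 = r]. *)
have r0 : (0 < r)%N by near: r; exact: nbhs_infty_ge.
have pq : k r.-1 < k r by apply: kincr; rewrite prednK.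
have kE : (`|k r|%N%:R : R) = (k r)%:~R.
  by rewrite natr_absz gtr0_norm// (lt_trans p0).
apply/andP; split.
  apply: mulr_ge0; last by apply: sumr_ge0 => m _; exact: arith_dev_ge0.
  by rewrite invr_ge0 ler0z /lac_gap subr_ge0 ltW.
rewrite mulrA; apply: ler_pM.
- by rewrite invr_ge0 ler0z /lac_gap subr_ge0 ltW.
- by apply: sumr_ge0 => m _; exact: arith_dev_ge0.
- by rewrite kE /lac_gap rmorphB; apply: gap_inv_le; rewrite ?ltr0z.
(* Terms outside the block become 0, which is at most the nonnegative deviation. *)
- rewrite big_mkcond; apply: ler_sum => m _.
  by case: ifP => // _; exact: arith_dev_ge0.
Unshelve. all: by end_near. Qed.
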